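(* Let $T$ be a sublinear operator acting on measurable functions on $\mathbb{R}^n$ such that, for some admissible function $\varphi$ and some constant $C>0$, for every $1\le p<\infty$ and every $f$, $$\|Tf\|_{L^{p,\infty}}\le C\,\varphi(p)\,\|f\|_{L^{p,1}},$$ with $C$ independent of $p$. Then there is a constant $C'>0$ such that, for every $t>0$ and every measurable function $f$, $$(Tf)^*(t)\le C'\left(\frac1t\int_0^t f^*(s)\,ds+\int_t^\infty\left(1+\log\frac st\right)^{-1}\varphi\left(1+\log\frac st\right)f^*(s)\,\frac{ds}{s}\right).$$
   Context: A function $\varphi:[1,\infty]\to[1,\infty]$ is called admissible if: (a) $\varphi(1)=1$ and $\varphi$ is log-concave, i.e. $\theta\log\varphi(x)+(1-\theta)\log\varphi(y)\le\log\varphi(\theta x+(1-\theta)y)$ for all $x,y\ge1$ and $0\le\theta\le1$; and (b) there exist $\gamma,\beta>0$ such that $\frac{\gamma}{x}\le\frac{\varphi'(x)}{\varphi(x)}\le\frac{\beta}{x}$ for every $x\ge1$. The decreasing rearrangement with respect to Lebesgue measure on $\mathbb{R}^n$ is $f^*(t)=\inf\{s>0:|\{|f|>s\}|\le t\}$. The Lorentz (quasi-)norms, with respect to Lebesgue measure, are $\|f\|_{L^{p,\infty}}=\sup_{t>0}t^{1/p}f^*(t)$ and $\|f\|_{L^{p,1}}=\frac1p\int_0^\infty f^*(s)\,s^{\frac1p-1}\,ds=\int_0^\infty|\{|f|>y\}|^{1/p}\,dy$, normalized so that $\|\chi_E\|_{L^{p,1}}=|E|^{1/p}$.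
   Formalization: As stated this fails for merely finitely sublinear T; the estimate is proved for each measurable f that lies in L^1+L^{p,1} for some p<∞, or at which T is countably sublinear: |Tf| ≤ Σ_k |T(fχ_{E_k})| a.e. for every countable measurable partition (E_k). *)

(* Defs.v *)
From HB Require Import structures.
From mathcomp Require Import all_boot all_order all_algebra.
From mathcomp Require Import all_classical all_reals all_analysis.
From mathcomp Require Import measurable_realfun.
Set Implicit Arguments.
Unset Strict Implicit.
Unset Printing Implicit Defensive.
Import Order.TTheory GRing.Theory Num.Theory.
Import numFieldNormedType.Exports.
Local Open Scope classical_set_scope.
Local Open Scope ring_scope.
Local Open Scope ereal_scope.

(* [n.-tuple R] carries the library's product (Borel) sigma-algebra; Lebesgue
   measure on it is built by recursion on [n], as the image of
   [lebesgue_measure \x (Lebesgue measure in dimension n)] under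
   [(a, x) |-> a :: x]. *)
Section lebesgue_measure_tuple.
Context {R : realType}.

Section cons_measure.
Variables (n : nat) (m : {sigma_finite_measure set (n.-tuple R) -> \bar R}).

Let cons_pair (x : R * n.-tuple R) : n.+1.-tuple R :=
  [the n.+1.-tuple R of x.1 :: x.2].

Let measurable_cons_pair : measurable_fun setT cons_pair.
Proof. exact: measurable_cons. Qed.

Definition lebesgue_cons : set (n.+1.-tuple R) -> \bar R :=
  pushforward (@lebesgue_measure R \x m) cons_pair.

Let lebesgue_cons0 : lebesgue_cons set0 = 0.
Proof. by rewrite /lebesgue_cons /pushforward preimage_set0 measure0. Qed.

Let lebesgue_cons_ge0 A : 0 <= lebesgue_cons A.
Proof. exact: measure_ge0. Qed.

Let lebesgue_cons_sigma_additive : semi_sigma_additive lebesgue_cons.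
Proof.
move=> F mF tF mUF; rewrite /lebesgue_cons /pushforward preimage_bigcup.
apply: measure_semi_sigma_additive.
- by move=> k; rewrite -[X in measurable X]setTI; exact: measurable_cons_pair.
- apply/trivIsetP => i j _ _ ij; rewrite -preimage_setI.
  by move/trivIsetP : tF => /(_ _ _ _ _ ij) ->//; rewrite preimage_set0.
- by rewrite -preimage_bigcup -[X in measurable X]setTI;
    exact: measurable_cons_pair.
Qed.

HB.instance Definition _ := isMeasure.Build _ _ _ lebesgue_cons
  lebesgue_cons0 lebesgue_cons_ge0 lebesgue_cons_sigma_additive.

Let lebesgue_cons_sigma_finite : sigma_finite setT lebesgue_cons.
Proof.
have /sigma_finiteP[F [FT ndF Foo]] := sigma_finiteT (@lebesgue_measure R).
have /sigma_finiteP[G [GT ndG Goo]] := sigma_finiteT m.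
pose uncons (x : n.+1.-tuple R) : R * n.-tuple R :=
  (tnth x ord0, [tuple of behead x]).
have unconsK : cancel cons_pair uncons.
  by case=> a x; congr pair => //; exact/val_inj.
have consK : cancel uncons cons_pair.
  by move=> x; rewrite [RHS]tuple_eta; exact/val_inj.
have muncons : measurable_fun setT uncons.
  by apply/measurable_fun_pair; [exact: measurable_tnth|exact: measurable_behead].
exists (fun k => uncons @^-1` (F k `*` G k)).
  apply/seteqP; split => // x _.
  have [i _ Fi] : (\bigcup_k F k) (uncons x).1 by rewrite -FT.
  have [j _ Gj] : (\bigcup_k G k) (uncons x).2 by rewrite -GT.
  exists (maxn i j) => //=; split.
  - by move: Fi; apply/subsetPset/ndF/leq_maxl.
  - by move: Gj; apply/subsetPset/ndG/leq_maxr.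
move=> k; have [mF Fk] := Foo k; have [mG Gk] := Goo k; split.
  by rewrite -[X in measurable X]setTI; apply: muncons => //; exact: measurableX.
rewrite /lebesgue_cons /pushforward -comp_preimage.
rewrite (_ : uncons \o cons_pair = id) ?preimage_id; last exact/funext.
by rewrite product_measure1E// lte_mul_pinfty// ge0_fin_numE.
Qed.

HB.instance Definition _ := Measure_isSigmaFinite.Build _ _ _ lebesgue_cons
  lebesgue_cons_sigma_finite.

End cons_measure.

Fixpoint lebesgue_tuple n : {sigma_finite_measure set (n.-tuple R) -> \bar R} :=
  match n with
  | 0 => \d_ ([tuple] : 0.-tuple R)
  | n'.+1 => lebesgue_cons (lebesgue_tuple n')
  end.

Lemma lebesgue_tuple_box n (A : 'I_n -> set R) : (forall i, measurable (A i)) ->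
  lebesgue_tuple n [set x | forall i, A i (tnth x i)] =
  \prod_(i < n) lebesgue_measure (A i).
Proof.
elim: n A => [|n IH] A mA.
  by rewrite big_ord0/= diracE mem_set//; case.
rewrite big_ord_recl -IH//= /lebesgue_cons /pushforward -product_measure1E//=.
  congr (_ \x _)%E; apply/seteqP; split => -[a x]/=.
    by move=> Aax; split; [exact: (Aax ord0)|
      move=> i; have := Aax (lift ord0 i); rewrite tnthS].
  case=> Aa Ax i; case: (unliftP ord0 i) => [j|] ->; last exact: Aa.
  by rewrite tnthS.
  exact: mA.
have -> : [set x : n.-tuple R | forall i, A (lift ord0 i) (tnth x i)] =
    \bigcap_(i in [set: 'I_n]) ((@tnth n R)^~ i @^-1` A (lift ord0 i)).
  by apply/seteqP; split => x /= Ax i; [move=> _|]; exact: Ax.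
apply: fin_bigcap_measurable => // i _.
by rewrite -[X in measurable X]setTI; exact: measurable_tnth.
Qed.

End lebesgue_measure_tuple.

Section lorentz.
Context d (X : measurableType d) {R : realType} (mu : set X -> \bar R).
Implicit Types (f : X -> \bar R) (p t : R).

(* [ereal_inf set0 = +oo]. *)
Definition rearrangement f t : \bar R :=
  ereal_inf [set s%:E | s in
    [set s : R | (0 < s)%R /\ mu [set x | s%:E < `|f x|] <= t%:E]].

Definition lorentz_weak p f : \bar R :=
  ereal_sup [set (t `^ p^-1)%:E * rearrangement f t | t in [set t | (0 < t)%R]].

Definition lorentz_strong p f : \bar R :=
  (p^-1)%:E * \int[lebesgue_measure]_(s in `]0%R, +oo[)
    (rearrangement f s * (s `^ (p^-1 - 1))%:E).

End lorentz.

Section admissible.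
Context {R : realType}.
Implicit Types phi : R -> R.

(* Derivative relative to [1, +oo[, hence one-sided at [1]. *)
Definition is_derive_from1 phi (x l : R) : Prop :=
  ((phi y - phi x) / (y - x))%R @[y --> within `[1%R, +oo[ x^'] --> l.

(* Only the values of [phi] on [1, +oo[ are constrained. They are finite, since
   [phi] has a derivative at each of these points; the value at infinity plays
   no role. *)
Definition admissible phi : Prop :=
  [/\ forall x, (1 <= x)%R -> (1 <= phi x)%R,
      phi 1%R = 1%R,
      forall x y theta, (1 <= x)%R -> (1 <= y)%R -> (0 <= theta <= 1)%R ->
        (theta * ln (phi x) + (1 - theta) * ln (phi y) <=
         ln (phi (theta * x + (1 - theta) * y)))%R &
      exists gamma beta, [/\ (0 < gamma)%R, (0 < beta)%R &
        forall x, (1 <= x)%R -> exists l, is_derive_from1 phi x l /\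
          (gamma / x <= l / phi x <= beta / x)%R]].

End admissible.

Section sublinear.
Context d (X : measurableType d) {R : realType}.
Variables (mu : set X -> \bar R) (T : (X -> R) -> X -> \bar R).

(* [T f] is extended-real-valued, so that an operator defined on a linear
   subspace of the measurable functions is covered by giving it the value [+oo]
   off that subspace. *)
Definition sublinear_operator : Prop :=
  [/\ forall f : X -> R, measurable_fun setT f -> measurable_fun setT (T f),
      forall f g : X -> R, measurable_fun setT f -> measurable_fun setT g ->
        \forall x \ae mu, `|T (f \+ g)%R x| <= `|T f x| + `|T g x| &
      forall (a : R) (f : X -> R), measurable_fun setT f ->
        \forall x \ae mu, `|T (a \*o f)%R x| = `|a|%:E * `|T f x|].

(* [f] belongs to L^1 + L^{p,1} for some [p], that is, to the linear span of
   the spaces L^{q,1}, [1 <= q < +oo]. *)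
Definition in_lorentz_sum (f : X -> R) : Prop :=
  exists (p : R) (g h : X -> R),
    [/\ (1 <= p)%R, measurable_fun setT g, measurable_fun setT h,
        f = (g \+ h)%R &
        lorentz_strong mu 1 (EFin \o g) < +oo /\
        lorentz_strong mu p (EFin \o h) < +oo].

(* On the span of the L^{q,1} the restricted weak-type bounds force this
   property. Off it they give no information on [T f], and subadditivity over
   finitely many terms does not control [T f] either: with [phi x = x], the
   operator sending [f] to the constant
   limsup_(s -> +oo) (ln s)^2 f^*(s) is sublinear and vanishes on every
   L^{q,1}, but not on f(x) = (1 + ln (1 + |x|))^-2, for which
   (1/t) \int_0^t f^* + \int_t^oo f^*(s) ds/s tends to 0 as t -> +oo. *)
Definition countably_sublinear_at (f : X -> R) : Prop :=
  forall E : (set X)^nat, (forall k, measurable (E k)) -> trivIset setT E ->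
    \bigcup_k E k = setT ->
    \forall x \ae mu,
      `|T f x| <= \sum_(0 <= k <oo) `|T (fun y => f y * \1_(E k) y)%R x|.

End sublinear.

(* Main.v *)
Require Import Defs.
From mathcomp Require Import all_boot all_order all_algebra.
From mathcomp Require Import all_classical all_reals all_analysis.
From mathcomp Require Import measurable_realfun.
From mathcomp Require Import ring lra.
Set Implicit Arguments.
Unset Strict Implicit.
Unset Printing Implicit Defensive.
Import Order.TTheory GRing.Theory Num.Theory.
Import numFieldNormedType.Exports.
Local Open Scope classical_set_scope.
Local Open Scope ring_scope.
Local Open Scope ereal_scope.

(** Cut [f] at the heights [f^*(s_k)], [s_k = t exp(2^k)]. The part above
    [f^*(s_0)] is handled with [p = 1]. The part between [f^*(s_(k+1))] and
    [f^*(s_k)] is bounded by [f^*(s_k)] and lives on a set of measure at most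
    [s_(k+1)]; with [p = 2^(k+1)] its image exceeds a multiple of
    [phi(2^(k+1)) f^*(s_k)] only on a set of measure [t / 2^(k+3)]. These measures
    sum to less than [t], so [(T f)^*(t)] is at most the sum of the heights. Since
    [phi] is doubling, [phi(2^(k+1)) f^*(s_k)] is controlled by the integral of
    [phi(1+u)/(1+u) f^*(t e^u)] over [2^(k-1) < u < 2^k]. *)

(** For a function of height 1 on a set of measure [s], the weak-type bound at [t] is
    [phi(p) (s/t)^(1/p)] up to the constant. Taking [p = ln (s/t)] makes the second factor equal to
    [e]; with [s = s_(k+1)] this is [p = 2^(k+1)], whence the doubly exponential scale. Weak
    quasi-norms cannot be summed with a constant independent of the number of terms, so heights are
    added pointwise off a union of exceptional sets. Giving piece [k+1] the measure [t / 2^(k+3)] in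
    place of [t] costs the factor [2^((k+3)/p)], which is at most 4. Two obstacles remain. The
    heights [f^*(s_k)] need not tend to 0, so the pieces may fail to exhaust [f]; the sum of the
    bounds is then infinite and there is nothing to prove. And [T] is subadditive over finitely many
    terms only, so a tail must be controlled separately, by norm convergence or by countable
    sublinearity. *)

(** * Decreasing rearrangement and distribution function *)

Section rearrangement_theory.
Context d (X : measurableType d) {R : realType}.
Variable mu : {measure set X -> \bar R}.
Implicit Types (f g : X -> \bar R) (s t : R) (a : \bar R).

Lemma measurable_superlevel f a : measurable_fun setT f ->
  measurable [set x | a < `|f x|].
Proof.
move=> mf; rewrite (_ : mkset _ = setT `&` (abse \o f) @^-1` `]a, +oo[).
  by apply: (measurableT_comp _ mf) => //; exact: emeasurable_itv.
rewrite setTI; apply/seteqP; split => x /=; rewrite in_itv/= ?andbT//.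
Qed.

Lemma rearrangement_ge0 f t : 0 <= rearrangement mu f t.
Proof.
by apply: le_ereal_inf_tmp => _ [s [s0 _] <-]; rewrite lee_fin ltW.
Qed.

Lemma rearrangement_nincr f : {homo rearrangement mu f : s t / (s <= t)%R >-> t <= s}.
Proof.
move=> s t st; apply: le_ereal_inf_tmp => _ [r [r0 rs] <-].
by apply: ereal_inf_lbound; exists r => //; split => //; rewrite (le_trans rs).
Qed.

(** The infimum ranges over positive reals, so [a = 0] is not a candidate; [a + e] is one for every
    [e > 0]. *)
Lemma rearrangement_le f t a : measurable_fun setT f -> 0 <= a ->
  mu [set x | a < `|f x|] <= t%:E -> rearrangement mu f t <= a.
Proof.
move=> mf; case: a => [r| |]//; last by move=> *; rewrite leey.
rewrite lee_fin => r0 rt; apply/lee_addgt0Pr => e e0.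
apply: ereal_inf_lbound; exists (r + e)%R => //; split; first exact: ltr_wpDl.
apply: le_trans rt; apply: le_measure; rewrite ?inE; try exact: measurable_superlevel.
by move=> x /=; apply: le_lt_trans; rewrite lee_fin lerDl ltW.
Qed.

(** Continuity of [mu] from below: [{|f| > r}] is the increasing union of the sets
    [{|f| > r + 1/(n+1)}], so the bound by [t] survives at the infimum itself. *)
Lemma superlevel_le f t a : measurable_fun setT f -> (0 <= t)%R ->
  rearrangement mu f t <= a -> mu [set x | a < `|f x|] <= t%:E.
Proof.
move=> mf t0; case: a => [r| |] ra.
- pose F n := [set x | (r + n.+1%:R^-1)%:E < `|f x|].
  have mF n : measurable (F n) by exact: measurable_superlevel.
  have Ft n : mu (F n) <= t%:E.
    have : rearrangement mu f t < (r + n.+1%:R^-1)%:E.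
      by rewrite (le_lt_trans ra)// lte_fin ltrDl invr_gt0.
    move=> /ereal_inf_lt[_ [s [s0 st] <-]] sr; apply: le_trans st.
    apply: le_measure; rewrite ?inE//; first exact: measurable_superlevel.
    by move=> x /=; apply: lt_trans.
  have -> : [set x | r%:E < `|f x|] = \bigcup_n F n.
    apply/seteqP; split => x /=; last first.
      by move=> [n _]; apply: lt_trans; rewrite lte_fin ltrDl invr_gt0.
    case fx : (`|f x|) => [y| |]//.
      rewrite lte_fin => ry; exists (Num.truncn (y - r)^-1) => //.
      rewrite /F /= fx lte_fin -ltrBrDl.
      rewrite invf_plt ?posrE ?subr_gt0//.
      by rewrite truncnS_gt.
    by move=> _; exists 0%N => //; rewrite /F /= fx ltry.
  have ndF : {homo F : n m / (n <= m)%N >-> (n <= m)%O}.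
    move=> n m nm; apply/subsetPset => x; rewrite /F /=; apply: le_lt_trans.
    by rewrite lee_fin lerD2l lef_pV2 ?posrE// ler_nat ltnS.
  have cF := nondecreasing_cvg_mu (mu := mu) mF (bigcupT_measurable F mF) ndF.
  rewrite -(cvg_lim _ cF)//; apply: lime_le; first by apply/cvg_ex; eexists; exact: cF.
  by apply: nearW => n; exact: Ft.
- rewrite (_ : mkset _ = set0) ?measure0 ?lee_fin//.
  by apply/seteqP; split => x //=; rewrite ltNge leey.
- by have := le_trans (rearrangement_ge0 f t) ra; rewrite leeNy_eq.
Qed.

(** Galois connection between rearrangement and distribution function, through which bounds on [f^*]
    are traded for bounds on measures of level sets. *)
Lemma rearrangement_leP f t a : measurable_fun setT f -> (0 <= t)%R -> 0 <= a ->
  (rearrangement mu f t <= a) = (mu [set x | a < `|f x|] <= t%:E).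
Proof.
by move=> *; apply/idP/idP; [exact: superlevel_le|exact: rearrangement_le].
Qed.

Lemma le_rearrangement f g t : measurable_fun setT f -> measurable_fun setT g ->
  (forall x, `|f x| <= `|g x|) -> rearrangement mu f t <= rearrangement mu g t.
Proof.
move=> mf mg fg; apply: le_ereal_inf_tmp => _ [r [r0 rt] <-].
apply: ereal_inf_lbound; exists r => //; split => //; apply: le_trans rt.
apply: le_measure; rewrite ?inE; try exact: measurable_superlevel.
by move=> x /= /lt_le_trans; apply.
Qed.

Lemma measurable_rearrangement f (D : set R) : measurable D ->
  measurable_fun D (rearrangement mu f).
Proof.
move=> mD; apply: (measurability _ (ErealGenOInfty.measurableE R)) => //.
move=> _ [_ [r ->] <-]; apply: measurableI => //.
apply: is_interval_measurable => s t/=.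
rewrite !in_itv/= !andbT => fs ft u /andP[su ut].
by rewrite in_itv/= andbT (lt_le_trans ft)// rearrangement_nincr.
Qed.

End rearrangement_theory.

(** * Integrals of powers near the origin *)

Section lorentz_norm.
Context {R : realType}.
Local Notation leb := (@lebesgue_measure R).
Implicit Types (a b p q r s t S x : R).

Lemma nneg_cvge0 (u : (\bar R)^nat) : (forall n, 0 <= u n) ->
  (forall e : R, (0 < e)%R -> \forall n \near \oo, u n <= e%:E) ->
  u @ \oo --> 0.
Proof.
move=> u0 ue; apply/fine_cvgP; split.
  near=> n; rewrite ge0_fin_numE ?u0//.
  by rewrite (@le_lt_trans _ _ 1%:E) ?ltry//; near: n; exact: ue.
apply/cvgrPdist_le => e e0; near=> n; rewrite sub0r normrN ger0_norm ?fine_ge0//=.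
rewrite -lee_fin fineK; first by near: n; exact: ue.
rewrite ge0_fin_numE ?u0//.
by rewrite (@le_lt_trans _ _ e%:E) ?ltry//; near: n; exact: ue.
Unshelve. all: end_near. Qed.

Lemma measurable_EFin_powR q (D : set R) :
  measurable_fun D (fun s : R => (s `^ q)%:E).
Proof. by apply/measurable_EFinP/measurable_funTS; exact: measurable_powR. Qed.

Lemma integral_powR_itv q a b : (0 < q)%R -> (0 < a)%R -> (a < b)%R ->
  \int[leb]_(s in `[a, b]) (s `^ (q - 1))%:E = (q^-1 * (b `^ q - a `^ q))%:E.
Proof.
move=> q0 a0 ab.
pose F x : R := (q^-1 * x `^ q)%R.
have dF (x : R) : (0 < x)%R -> is_derive x 1%R F (x `^ (q - 1))%R.
  move=> x0; have := @is_derive1_powR R q x x0.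
  move=> /(@is_deriveZ _ _ _ _ q^-1%R).
  by rewrite /GRing.scale/= mulrA mulVf ?gt_eqF// mul1r.
have cF (x : R) : (0 < x)%R -> {for x, continuous F}.
  by move=> x0; apply/differentiable_continuous/derivable1_diffP; have [] := dF _ x0.
rewrite (@continuous_FTC2 _ _ F)//.
- by rewrite -EFinB /F -mulrBr.
- apply: continuous_in_subspaceT => x; rewrite inE/= in_itv/= => /andP[ax _].
  have x0 : (0 < x)%R by exact: lt_le_trans ax.
  apply: differentiable_continuous; apply/derivable1_diffP.
  by have [] := @is_derive1_powR R (q - 1) x x0.
- split.
  + move=> x; rewrite in_itv/= => /andP[ax _].
    by have [] := dF _ (lt_trans a0 ax).
  + exact/cvg_at_right_filter/cF.
  + exact/cvg_at_left_filter/cF/(lt_trans a0).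
- move=> x; rewrite in_itv/= => /andP[ax _].
  by rewrite derive1E; have [_ ->] := dF _ (lt_trans a0 ax).
Qed.

(** For [q < 1] the integrand blows up at 0, out of reach of the fundamental theorem of calculus;
    monotone convergence along intervals shrinking away from 0 replaces it. *)
Lemma integral_powR0 q S : (0 < q)%R -> (0 < S)%R ->
  \int[leb]_(s in `]0%R, S[) (s `^ (q - 1))%:E = (q^-1 * S `^ q)%:E.
Proof.
move=> q0 S0.
rewrite integral_itv_bndo_bndc; last exact: measurable_EFin_powR.
(* [n.+2] keeps the left endpoint strictly below [S], as [integral_powR_itv] requires. *)
pose F n := `[(S / n.+2%:R)%R, S]%classic.
have ndF : {homo F : n m / (n <= m)%N >-> (n <= m)%O}.
  move=> n m nm; apply/subsetPset; apply: subset_itvr; rewrite bnd_simp.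
  by rewrite ler_pM2l// lef_pV2 ?posrE// ler_nat !ltnS.
have SF : `]0%R, S]%classic = \bigcup_n F n.
  apply/seteqP; split => x /=; rewrite in_itv/=.
    move=> /andP[x0 xS]; exists (Num.truncn (S / x)) => //.
    rewrite /F/= in_itv/= xS andbT ler_pdivrMr// mulrC -ler_pdivrMr//.
    by rewrite (le_trans (ltW (truncnS_gt _)))// ler_nat.
  by move=> [n _]; rewrite /F/= in_itv/= => /andP[+ ->]; rewrite andbT;
    apply: lt_le_trans; rewrite divr_gt0.
have cF : \int[leb]_(s in F n) (s `^ (q - 1))%:E @[n --> \oo] -->
    \int[leb]_(s in \bigcup_n F n) (s `^ (q - 1))%:E.
  apply: ge0_nondecreasing_set_cvg_integral => // [n|n|n s _].
  - exact: measurable_itv.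
  - exact: measurable_EFin_powR.
  - by rewrite lee_fin powR_ge0.
rewrite -SF in cF.
apply/esym/(cvg_unique _ _ cF) => //.
have -> : (fun n => \int[leb]_(x in F n) (x `^ (q - 1))%:E) =
   EFin \o (fun n => (q^-1 * (S `^ q - (S / n.+2%:R) `^ q))%R).
  apply/funext => n /=; rewrite /F integral_powR_itv// ?divr_gt0//.
  by rewrite ltr_pdivrMr// ltr_pMr// ltr1n.
apply/cvg_EFin; first by near=> n.
rewrite /comp/= -[in X in _ --> X](subr0 (S `^ q)%R).
apply: cvgM; first exact: cvg_cst.
apply: cvgB; first exact: cvg_cst.
apply: (cvg_at_rightP _ _ _).1 (powR_cvg0 q0) _ _.
split=> [n|]; first by rewrite divr_gt0.
rewrite -(mulr0 S); apply: cvgM; first exact: cvg_cst.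
by rewrite (cvg_shiftS (@harmonic R)); exact: cvg_harmonic.
Unshelve. all: end_near. Qed.

End lorentz_norm.

(** * The norm of [L^{p,1}]: bounded functions, finiteness, absolute continuity *)

Section lorentz_strong_theory.
Context d (X : measurableType d) {R : realType}.
Variable mu : {measure set X -> \bar R}.
Local Notation leb := (@lebesgue_measure R).
Implicit Types (h : X -> \bar R) (p S t : R).

Let measurable_weight h p (D : set R) : measurable D ->
  measurable_fun D (fun s => rearrangement mu h s * (s `^ (p^-1 - 1))%:E).
Proof.
move=> mD; apply: emeasurable_funM; first exact: measurable_rearrangement.
exact: measurable_EFin_powR.
Qed.

Let weight_ge0 h p s : 0 <= rearrangement mu h s * (s `^ (p^-1 - 1))%:E.
Proof. by rewrite mule_ge0 ?rearrangement_ge0// lee_fin powR_ge0. Qed.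

(** By the Galois connection at height 0, the rearrangement vanishes from [S] on. *)
Lemma lorentz_strong_support p h S : measurable_fun setT h -> (0 <= S)%R ->
  mu [set x | 0 < `|h x|] <= S%:E ->
  lorentz_strong mu p h = (p^-1)%:E * \int[leb]_(s in `]0%R, S[)
    (rearrangement mu h s * (s `^ (p^-1 - 1))%:E).
Proof.
move=> mh S0 hS; rewrite /lorentz_strong; congr (_ * _).
rewrite [in RHS](_ : `]0%R, S[%classic = `]0%R, +oo[ `&` `]0%R, S[); last first.
  by rewrite setIidr//; apply: subset_itvl.
rewrite [RHS]integral_mkcondr; apply: eq_integral => s.
rewrite inE/= in_itv/= andbT patchE => s0.
case: ifPn => //; rewrite notin_setE/= in_itv/= s0/= => /negP.
rewrite -leNgt => Ss.
have -> : rearrangement mu h s = 0; last by rewrite mul0e.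
apply/eqP; rewrite eq_le rearrangement_ge0 andbT.
by rewrite rearrangement_leP ?(le_trans hS) ?lee_fin// (le_trans S0).
Qed.

(** The comparison function is [c] on a set of measure [S], of norm exactly [c S^(1/p)]: no constant
    depending on [p] enters, which matters because [p] is unbounded over the pieces. [c] is extended
    since it will be a value of [f^*]. *)
Lemma lorentz_strong_bounded p h (c : \bar R) S : (0 < p)%R ->
  measurable_fun setT h -> (0 < S)%R ->
  mu [set x | 0 < `|h x|] <= S%:E -> 0 <= c -> (forall x, `|h x| <= c) ->
  lorentz_strong mu p h <= c * (S `^ p^-1)%:E.
Proof.
move=> p0 mh S0 hS c0 hc.
rewrite (@lorentz_strong_support p h S)//; last exact: ltW.
have q0 : (0 < p^-1)%R by rewrite invr_gt0.
apply: (@le_trans _ _ ((p^-1)%:E * (c * (p * S `^ p^-1)%:E))); last first.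
  by rewrite muleCA -EFinM mulrA mulVf ?gt_eqF// mul1r.
rewrite lee_pmul2l ?lte_fin// -[X in (X * S `^ _)%R]invrK -integral_powR0//.
rewrite -ge0_integralZl//; last 2 first.
- exact: measurable_EFin_powR.
- by move=> s _; rewrite lee_fin powR_ge0.
apply: ge0_le_integral => //.
- exact: measurable_weight.
- by apply: emeasurable_funM; [exact: measurable_cst|
    exact: measurable_EFin_powR].
- move=> s; rewrite /= in_itv/= => /andP[s0 _].
  apply: lee_wpmul2r; first by rewrite lee_fin powR_ge0.
  rewrite rearrangement_leP ?(ltW s0)//.
  rewrite (_ : mkset _ = set0) ?measure0 ?lee_fin ?(ltW s0)//.
  by apply/seteqP; split => x //=; rewrite ltNge hc.
Qed.

(** An infinite level set would force [h^* >= e] on the whole half-line, hence a norm of at least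
    [e S^(1/p)] for every [S]. The finiteness feeds continuity from above in the next lemma. *)
Lemma superlevel_lty p h (e : R) : (0 < p)%R -> measurable_fun setT h ->
  lorentz_strong mu p h < +oo -> (0 < e)%R ->
  mu [set x | e%:E < `|h x|] < +oo.
Proof.
move=> p0 mh hoo e0; rewrite ltNge leye_eq; apply/negP => /eqP muoo.
have q0 : (0 < p^-1)%R by rewrite invr_gt0.
have eh s : (0 <= s)%R -> e%:E <= rearrangement mu h s.
  move=> s0; rewrite leNgt; apply/negP => /ltW.
  by rewrite rearrangement_leP ?lee_fin ?(ltW e0)// muoo.
have eS S : (0 < S)%R -> (e * S `^ p^-1)%:E <= lorentz_strong mu p h.
  move=> S0; apply: (@le_trans _ _ ((p^-1)%:E * (e%:E * (p * S `^ p^-1)%:E))).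
    by rewrite -!EFinM mulrCA mulKf ?gt_eqF.
  rewrite lee_pmul2l ?lte_fin// -[X in (X * S `^ _)%R]invrK -integral_powR0//.
  rewrite -ge0_integralZl//; last 3 first.
  - exact: measurable_EFin_powR.
  - by move=> s _; rewrite lee_fin powR_ge0.
  - by rewrite lee_fin ltW.
  apply: (@le_trans _ _ (\int[leb]_(s in `]0%R, S[)
      (rearrangement mu h s * (s `^ (p^-1 - 1))%:E))).
    apply: ge0_le_integral => //.
    + by move=> s _; rewrite mule_ge0 ?lee_fin ?powR_ge0// ltW.
    + by apply: emeasurable_funM; [exact: measurable_cst|
    exact: measurable_EFin_powR].
    + exact: measurable_weight.
    + move=> s; rewrite /= in_itv/= => /andP[s0 _].
      by apply: lee_wpmul2r; [rewrite lee_fin powR_ge0|rewrite eh// ltW].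
  apply: ge0_subset_integral => //; first exact: measurable_weight.
  exact: subset_itvl.
have h0 : 0 <= lorentz_strong mu p h.
  by rewrite mule_ge0 ?lee_fin ?(ltW q0)// integral_ge0.
move: hoo eS h0; case: (lorentz_strong mu p h) => [L| |]// _ eS; rewrite lee_fin => L0.
have LS : (0 < (L + 1) / e)%R by rewrite divr_gt0// ltr_wpDl.
(* With [S = ((L + 1) / e)^p] the lower bound reads [L + 1 <= L]. *)
have := eS _ (powR_gt0 p LS).
rewrite -powRrM mulfV ?gt_eqF// powRr1 ?(ltW LS)// mulrCA mulfV ?gt_eqF// mulr1.
by rewrite lee_fin gerDl ler10.
Qed.

(** Dominated convergence in [s], the integrand of [h] being the majorant. The pointwise limit comes
    from continuity of [mu] from above on the sets [{|h| > e}] cut by [A k]. *)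
Lemma lorentz_strong_restrict_cvg0 p (h : X -> R) (A : (set X)^nat) : (0 < p)%R ->
  measurable_fun setT h -> lorentz_strong mu p (EFin \o h) < +oo ->
  (forall k, measurable (A k)) -> {homo A : n m / (n <= m)%N >-> (m <= n)%O} ->
  \bigcap_k A k = set0 ->
  lorentz_strong mu p (EFin \o (fun x => h x * \1_(A k) x)%R) @[k --> \oo] --> 0.
Proof.
move=> p0 mh hoo mA niA A0.
have q0 : (0 < p^-1)%R by rewrite invr_gt0.
have mEh : measurable_fun setT (EFin \o h) by exact/measurable_EFinP.
pose hA k x := (h x * \1_(A k) x)%R.
have mhA k : measurable_fun setT (EFin \o hA k).
  by apply/measurable_EFinP; apply: measurable_funM => //; exact: measurable_indic.
have hAle k x : `|(EFin \o hA k) x| <= `|(EFin \o h) x|.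
  rewrite /= lee_fin /hA normrM indicE; case: (_ \in _); rewrite ?normr1 ?mulr1//.
  by rewrite normr0 mulr0.
rewrite /lorentz_strong.
rewrite -[X in _ --> X](mule0 (p^-1)%:E); apply: cvgeZl => //.
pose g s := rearrangement mu (EFin \o h) s * (s `^ (p^-1 - 1))%:E.
have ig : leb.-integrable `]0%R, +oo[ g.
  apply/integrableP; split; first exact: measurable_weight.
  under eq_integral do rewrite gee0_abs ?weight_ge0//.
  rewrite -(@lte_pmul2l _ (p^-1)%:E)// ?lte_fin//.
  rewrite gt0_muley ?lte_fin//.
have g0 : \forall s \ae leb, `]0%R, +oo[%classic s ->
    rearrangement mu (EFin \o hA k) s * (s `^ (p^-1 - 1))%:E @[k --> \oo] --> 0.
  apply: aeW => s; rewrite /= in_itv/= andbT => s0.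
  rewrite -[X in _ --> X](mul0e (s `^ (p^-1 - 1))%:E); apply: cvgeZr => //.
  apply: nneg_cvge0 => [n|e e0]; first exact: rearrangement_ge0.
  have lev k : [set x | e%:E < `|(EFin \o hA k) x|] =
      [set x | e%:E < `|(EFin \o h) x|] `&` A k.
    apply/seteqP; split => x; rewrite /= /hA indicE.
      have [xA|xA] := boolP (x \in A k); last first.
        by rewrite mulr0 normr0 lte_fin ltNge (ltW e0).
      by rewrite mulr1; split => //; exact: set_mem.
    by move=> [eh xA]; rewrite mem_set// mulr1.
  have mL : measurable [set x | e%:E < `|(EFin \o h) x|].
    exact: measurable_superlevel.
  pose F k := [set x | e%:E < `|(EFin \o h) x|] `&` A k.
  have capF : \bigcap_k F k = set0.
    by rewrite /F bigcapIr ?A0 ?setI0//; exists 0%N.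
  have : mu \o F @ \oo --> mu (\bigcap_k F k).
    apply: nonincreasing_cvg_mu.
    + rewrite (le_lt_trans _ (superlevel_lty p0 mEh hoo e0))//.
      by apply: le_measure; rewrite ?inE//; [exact: measurableI|exact: subIsetl].
    + by move=> k; exact: measurableI.
    + by rewrite capF.
    + by move=> n m nm; apply/subsetPset; have /subsetPset := niA _ _ nm;
        exact: setIS.
  rewrite capF measure0 => /fine_cvgP[Ffin /cvgrPdist_le/(_ s s0) Fs].
  (* After the Galois connection, [mu (F k) <= s] suffices; it holds eventually because [s > 0]. *)
  near=> k; rewrite rearrangement_leP ?(ltW s0) ?lee_fin ?(ltW e0)//.
  rewrite lev -/(F k) -[mu _]fineK; last by near: k.
  rewrite lee_fin.
  have : (`|0 - (fine \o (mu \o F)) k| <= s)%R by near: k.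
  by rewrite sub0r normrN; apply: le_trans; exact: ler_norm.
have gle : \forall s \ae leb, forall k, `]0%R, +oo[%classic s ->
    `|rearrangement mu (EFin \o hA k) s * (s `^ (p^-1 - 1))%:E| <= g s.
  apply: aeW => s k; rewrite /= in_itv/= andbT => s0.
  rewrite gee0_abs// lee_wpmul2r ?lee_fin ?powR_ge0//.
  exact: le_rearrangement.
have mg k : measurable_fun (`]0%R, +oo[%classic : set R) (fun s : R =>
    rearrangement mu (EFin \o hA k) s * (s `^ (p^-1 - 1))%:E).
  by apply: measurable_weight; exact: measurable_itv.
have m0 : measurable_fun (`]0%R, +oo[%classic : set R) (fun=> 0 : \bar R) :=
  measurable_cst _.
have [_ _] := dominated_convergence (mu := leb) (measurable_itv _) mg m0 g0 ig gle.
by rewrite integral0.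
Unshelve. all: end_near. Qed.

End lorentz_strong_theory.

(** * From bounds on the pieces to a bound on [T f] *)

Section summation.
Context d (X : measurableType d) {R : realType}.
Variable mu : {measure set X -> \bar R}.
Implicit Types (f g h : X -> R) (t : R).

(** Union bound over the sets where some piece exceeds its height. [G] is an extra exceptional set:
    empty under countable sublinearity, the bad sets of two tails otherwise. *)
Lemma superlevel_le_sum (F : X -> \bar R) (Fk : nat -> X -> \bar R)
    (a tau : nat -> \bar R) (b : \bar R) (G : set X) :
  measurable_fun setT F -> (forall k, measurable_fun setT (Fk k)) -> measurable G ->
  (forall k, mu [set x | a k < `|Fk k x|] <= tau k) ->
  {ae mu, forall x, ~ G x -> (forall k, `|Fk k x| <= a k) -> `|F x| <= b} ->
  mu [set x | b < `|F x|] <= mu G + \sum_(0 <= k <oo) tau k.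
Proof.
move=> mF mFk mG Fka [N [mN N0 FN]].
pose L k := [set x | a k < `|Fk k x|].
have mL k : measurable (L k) by exact: measurable_superlevel.
have mUL : measurable (\bigcup_k L k) by exact: bigcupT_measurable.
apply: (@le_trans _ _ (mu (G `|` (\bigcup_k L k) `|` N))).
  apply: le_measure; rewrite ?inE; [exact: measurable_superlevel| |].
    by apply: measurableU => //; exact: measurableU.
  move=> x bF; apply: contrapT => /not_orP[/not_orP[nG nL] nN].
  apply: nN; apply: FN => /= /(_ nG) FL; move: bF; rewrite /= ltNge FL// => k.
  by rewrite leNgt; apply/negP => ?; apply: nL; exists k.
rewrite measureU0//; last exact: measurableU.
apply: le_trans (measureU2 mu mG mUL) _; rewrite leeD2l//.
apply: (@le_trans _ _ (\sum_(0 <= k <oo) mu (L k))).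
  exact: measure_sigma_subadditive.
by apply: lee_nneseries => [k _ _|k _]; [exact: measure_ge0|exact: Fka].
Qed.

Section weak_type.
Variables (T : (X -> R) -> X -> \bar R) (M : R -> R).
Hypothesis T_sub : sublinear_operator mu T.
Hypothesis M_gt0 : forall p, (1 <= p)%R -> (0 < M p)%R.
Hypothesis T_weak : forall p f, (1 <= p)%R -> measurable_fun setT f ->
  lorentz_weak mu p (T f) <= (M p)%:E * lorentz_strong mu p (EFin \o f).

Lemma weak_type_superlevel p f (t : R) (a : \bar R) : (1 <= p)%R ->
  measurable_fun setT f -> (0 < t)%R -> 0 <= a ->
  (M p)%:E * lorentz_strong mu p (EFin \o f) <= (t `^ p^-1)%:E * a ->
  mu [set x | a < `|T f x|] <= t%:E.
Proof.
move=> p1 mf t0 a0 Ma; have [mT _ _] := T_sub.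
rewrite -rearrangement_leP ?(ltW t0)//; last exact: mT.
rewrite -(@lee_pmul2l _ (t `^ p^-1)%:E)// ?lte_fin ?powR_gt0//.
apply: le_trans Ma; apply: le_trans (T_weak p1 mf).
by apply: ereal_sup_ubound; exists t.
Qed.

Section partition.
Variables (f : X -> R) (E : (set X)^nat).
Hypotheses (mf : measurable_fun setT f) (mE : forall k, measurable (E k)).
Hypotheses (tE : trivIset setT E) (ET : \bigcup_k E k = setT).

Let tail K := \bigcup_(k in [set k | (K <= k)%N]) E k.

Let mtail K : measurable (tail K).
Proof. by apply: bigcup_measurable => k _. Qed.

Let mrestrict g (A : set X) : measurable_fun setT g -> measurable A ->
  measurable_fun setT (fun x => g x * \1_A x)%R.
Proof. by move=> mg mA; apply: measurable_funM => //; exact: measurable_indic. Qed.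

Let tail_recl K x : \1_(tail K) x = (\1_(E K) x + \1_(tail K.+1) x)%R :> R.
Proof.
have -> : tail K = E K `|` tail K.+1.
  apply/seteqP; split => y.
    move=> [k /= Kk Ey]; move: Kk; rewrite leq_eqVlt => /predU1P[->|Kk]; first by left.
    by right; exists k.
  by move=> [Ey|[k /= Kk Ey]]; [exists K => /=|exists k => //=; exact: ltnW].
rewrite !indicE in_setU.
have [xE|xE] := boolP (x \in E K); last by rewrite add0r.
rewrite memNset ?addr0// => -[k /= Kk Ex].
have : (E K `&` E k) !=set0 by exists x; split => //; exact: set_mem.
by move=> /(tE (i:=K) (j:=k) I I) Kk'; rewrite Kk' ltnn in Kk.
Qed.

(** Each induction step peels [E K] off the tail by disjointness; only finitely many null sets
    accumulate. *)
Lemma sublinear_split K : {ae mu, forall x,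
  `|T f x| <= \sum_(0 <= k < K) `|T (fun y => f y * \1_(E k) y)%R x| +
              `|T (fun y => f y * \1_(tail K) y)%R x| }.
Proof.
have [_ T_add _] := T_sub.
elim: K => [|K IH].
  apply: aeW => x; rewrite big_nil add0e.
  rewrite (_ : (fun y => _) = f)//; apply/funext => y.
  rewrite (_ : tail 0 = setT) ?indicE ?in_setT ?mulr1// -ET.
  by apply: eq_bigcupl => // k; split.
have := T_add _ _ (mrestrict mf (mE K)) (mrestrict mf (mtail K.+1)).
apply: filterS2 IH => x IH add; apply: le_trans IH _.
rewrite big_nat_recr//= -addeA leeD2l//; apply: le_trans add.
rewrite le_eqVlt; apply/orP; left; apply/eqP; congr (`|T _ x|).
by apply/funext => y; rewrite /= -mulrDr -tail_recl.
Qed.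

Lemma rearrangement_le_sum (t : R) (a tau : nat -> \bar R) : (0 < t)%R ->
  (forall k, 0 <= a k) ->
  (forall k, mu [set x | a k < `|T (fun y => f y * \1_(E k) y)%R x|] <= tau k) ->
  \sum_(0 <= k <oo) tau k <= (t / 2)%:E ->
  in_lorentz_sum mu f \/ countably_sublinear_at mu T f ->
  rearrangement mu (T f) t <= \sum_(0 <= k <oo) a k.
Proof.
move=> t0 a0 aE tau_le hyp; have [mT T_add _] := T_sub.
have mTE k : measurable_fun setT (T (fun y => f y * \1_(E k) y)%R).
  exact/mT/mrestrict.
have sum_ge0 : 0 <= \sum_(0 <= k <oo) a k by exact: nneseries_ge0.
have t4 : (0 < t / 4)%R by rewrite divr_gt0.
case: hyp => [|Tcount]; last first.
  apply: rearrangement_le => //; first exact: mT.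
  apply: le_trans (superlevel_le_sum (mT _ mf) mTE measurable0 aE _) _.
    have := Tcount _ mE tE ET; apply: filterS => x Tx _ xa.
    by apply: le_trans Tx _;
    apply: lee_nneseries => [k _ _|k _]; [exact: abse_ge0|exact: xa].
  rewrite measure0 add0e (le_trans tau_le)// lee_fin.
  by rewrite ler_pdivrMr// ler_peMr ?ler1n// ltW.
(* Only finitely many pieces can be split off here; the remaining tails of [g]
   and [h] tend to 0 in L^1 and L^{p,1} (although the tail of [f] is only in the
   sum of the two spaces), hence their images tend to 0 in measure. *)
move=> [p [g [h [p1 mg mh fgh [goo hoo]]]]].
(* The pieces use half of the measure [t]; each of the two tails gets [t / 4] of the rest and half
   of the spare height [e]. *)
apply/lee_addgt0Pr => e e0; have e2 : (0 < e / 2)%R by rewrite divr_gt0.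
have small q u : (1 <= q)%R -> measurable_fun setT u ->
    lorentz_strong mu q (EFin \o u) < +oo ->
    \forall K \near \oo,
      mu [set x | (e / 2)%:E < `|T (fun y => u y * \1_(tail K) y)%R x|] <= (t / 4)%:E.
  move=> q1 meas_u uoo.
  have nitail : {homo tail : n m / (n <= m)%N >-> (m <= n)%O}.
    move=> n m nm; apply/subsetPset; apply: bigcup_subset => k /=.
    exact: leq_trans.
  have tail0 : \bigcap_k tail k = set0.
    apply/seteqP; split => // x tx.
    have [k _ Ek] : (\bigcup_k E k) x by rewrite ET.
    have [j /= kj Ej] := tx k.+1 I.
    have : (E k `&` E j) !=set0 by exists x.
    by move=> /(tE (i:=k) (j:=j) I I) kj'; rewrite kj' ltnn in kj.
  have q0 : (0 < q)%R by exact: lt_le_trans q1.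
  have := lorentz_strong_restrict_cvg0 q0 meas_u uoo mtail nitail tail0.
  (* The norm for which the weak-type bound gives height [e / 2] off a set of measure [t / 4]. *)
  pose b : R := ((t / 4) `^ q^-1 * (e / 2) / M q)%R.
  have b0 : (0 < b)%R by rewrite divr_gt0 ?M_gt0// mulr_gt0// powR_gt0.
  move=> /fine_cvgP[ufin /cvgrPdist_le/(_ b b0) ub].
  near=> K; apply: (weak_type_superlevel q1) => //.
  - exact: mrestrict.
  - by rewrite lee_fin ltW.
  rewrite -[lorentz_strong _ _ _]fineK; last by near: K.
  rewrite -!EFinM lee_fin mulrC -ler_pdivlMr ?M_gt0//.
  have : (`|0 - (fine \o (fun k => lorentz_strong mu q
    (EFin \o (fun x => u x * \1_(tail k) x)%R))) K| <= b)%R by near: K.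
  by rewrite sub0r normrN; apply: le_trans; exact: ler_norm.
have /filter_ex[K [gK hK]] :
  \forall K \near \oo,
   mu [set x | (e / 2)%:E < `|T (fun y => g y * \1_(tail K) y)%R x|] <= (t / 4)%:E /\
   mu [set x | (e / 2)%:E < `|T (fun y => h y * \1_(tail K) y)%R x|] <= (t / 4)%:E.
  by near=> K; split; near: K; [exact: (small 1%R)|exact: (small p)].
set Gg := mkset _ in gK; set Gh := mkset _ in hK.
have mGg : measurable Gg by apply/measurable_superlevel/mT/mrestrict.
have mGh : measurable Gh by apply/measurable_superlevel/mT/mrestrict.
apply: rearrangement_le; [exact: mT|by rewrite adde_ge0// lee_fin ltW|].
apply: le_trans (superlevel_le_sum (mT _ mf) mTE (measurableU _ _ mGg mGh) aE _) _.
  have := T_add _ _ (mrestrict mg (mtail K)) (mrestrict mh (mtail K)).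
  apply: filterS2 (sublinear_split K) => x split_x add_x nG xa.
  apply: le_trans split_x _; apply: leeD.
    apply: le_trans (nneseries_lim_ge K _) => //.
    by apply: lee_sum => k _; exact: xa.
  rewrite (_ : (fun y => f y * \1_(tail K) y)%R =
    ((fun y => g y * \1_(tail K) y)%R \+ (fun y => h y * \1_(tail K) y)%R)%R).
    apply: le_trans add_x _; rewrite [e]splitr EFinD.
    move/not_orP : nG => [/negP nGg /negP nGh].
    by rewrite leeD// leNgt.
  by apply/funext => y; rewrite fgh /= mulrDl.
have -> : t%:E = (t / 4)%:E + (t / 4)%:E + (t / 2)%:E.
  by rewrite -!EFinD; congr EFin; lra.
by rewrite leeD// (le_trans (measureU2 mu mGg mGh))// leeD.
Unshelve. all: end_near. Qed.

End partition.
End weak_type.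
End summation.

(** * Growth of admissible functions *)

Section admissible_theory.
Context {R : realType}.
Implicit Types (phi : R -> R) (x y l : R).

(** Near a point [x > 1] the constraint [1 <= y] is vacuous, so the relative difference quotient is
    the ordinary one with [y = h + x]. *)
Lemma is_derive_from1_is_derive phi x l : (1 < x)%R ->
  is_derive_from1 phi x l -> is_derive x 1%R phi l.
Proof.
move=> x1 phixl.
have phi_cvg : (h^-1 *: ((phi \o shift x) (h *: 1) - phi x) @[h --> 0^'] --> l)%R.
  have -> : (fun h => h^-1 *: ((phi \o shift x) (h *: 1) - phi x))%R =
      (fun y => (phi y - phi x) / (y - x))%R \o (fun h => h + x)%R.
    by apply/funext => h; rewrite /= addrK /GRing.scale/= mulr1 mulrC.
  apply: cvg_comp; last exact: phixl.
  move=> P nP.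
  have {}nP : \forall y \near x, y != x -> `[1%R, +oo[%classic y -> P y := nP.
  have x1' : \forall y \near x, (1 <= y)%R.
    by have := lt_nbhsr x1; apply: filterS => y /ltW.
  have : \forall y \near x, (y != x -> `[1%R, +oo[%classic y -> P y) /\ (1 <= y)%R.
    exact: filterI.
  rewrite (@near_shift R R^o 0%R x) subr0.
  apply: filterS => h [/= hP h1] h0; apply: hP => /=; last by rewrite in_itv/= h1.
  by rewrite -[X in _ != X]add0r (inj_eq (addIr x)).
by split; [apply/cvg_ex; exists l|exact: cvg_lim].
Qed.

Lemma admissible_is_derive phi : admissible phi ->
  exists2 beta : R, (0 < beta)%R & forall x, (1 < x)%R ->
    exists2 l, is_derive x 1%R phi l & (l / phi x <= beta / x)%R.
Proof.
case=> _ _ _ [gamma [beta [_ beta0 H]]]; exists beta => // x x1.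
have [l [phil /andP[_ lb]]] := H _ (ltW x1).
by exists l => //; exact: is_derive_from1_is_derive.
Qed.

Lemma admissible_continuous phi x : admissible phi -> (1 < x)%R ->
  {for x, continuous phi}.
Proof.
move=> /admissible_is_derive[beta _ H] x1; have [l [dphi _] _] := H _ x1.
exact/differentiable_continuous/derivable1_diffP.
Qed.

(** Mean value theorem for [ln \o phi]: its slope at an intermediate [c] is at most
    [beta / c <= beta / x]. Cruder than [(y/x)^beta], but still bounded as soon as [y / x] is. *)
Lemma admissible_growth phi : admissible phi ->
  exists2 beta : R, (0 < beta)%R & forall x y, (1 < x)%R -> (x <= y)%R ->
    (phi y <= expR (beta * ((y - x) / x)) * phi x)%R.
Proof.
move=> phi_adm; have [beta beta0 H] := admissible_is_derive phi_adm.
exists beta => // x y x1 xy.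
have x0 : (0 < x)%R by exact: lt_trans x1.
have phi0 (z : R) : (1 <= z)%R -> (0 < phi z)%R.
  by move=> z1; case: phi_adm => /(_ z z1) + _ _ _; exact: lt_le_trans.
have dln (z : R) : (1 < z)%R -> is_derive z 1%R (@ln R \o phi)
    (derive1 phi z / phi z)%R.
  move=> z1; have [l dphi _] := H z z1.
  have := @is_derive1_comp _ (@ln R) phi z (phi z)^-1%R l.
  move=> /(_ (is_derive1_ln (phi0 _ (ltW z1))) dphi).
  by rewrite derive1E (@derive_val _ _ _ _ _ _ _ dphi) /GRing.scale/= mulrC.
have [] := @MVT_segment _ (@ln R \o phi) (fun z => derive1 phi z / phi z)%R x y xy.
- by move=> z; rewrite in_itv/= => /andP[xz _]; apply: dln; exact: lt_trans xz.
- apply: continuous_in_subspaceT => z; rewrite inE/= in_itv/= => /andP[xz _].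
  have [+ _] := dln z (lt_le_trans x1 xz).
  by move=> /derivable1_diffP/differentiable_continuous.
move=> c; rewrite in_itv/= => /andP[xc cy] /= lnphi.
have c1 : (1 < c)%R := lt_le_trans x1 xc.
have [l dphi lb] := H _ c1.
have dphic : derive1 phi c = l by rewrite derive1E (@derive_val _ _ _ _ _ _ _ dphi).
rewrite dphic in lnphi.
have phix := phi0 _ (ltW x1); have phiy := phi0 _ (le_trans (ltW x1) xy).
rewrite -ler_ln ?posrE//; last by rewrite mulr_gt0 ?expR_gt0.
rewrite lnM ?posrE ?expR_gt0// expRK -lerBlDr lnphi.
apply: (@le_trans _ _ (beta / c * (y - x))%R).
  by rewrite ler_wpM2r// subr_ge0.
rewrite -mulrA ler_wpM2l ?(ltW beta0)// [leRHS]mulrC ler_wpM2r ?subr_ge0//.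
by rewrite lef_pV2 ?posrE// (lt_trans _ c1).
Qed.

(** The ratio 4 is the one between [2^(k+1)] and the left end [2^k / 2] of a shell in the variable
    [ln (s / t)]; the exponent 3 is [(4x - x) / x]. *)
Lemma admissible_doubling phi : admissible phi -> exists2 D : R, (0 < D)%R &
  forall x y, (1 < x)%R -> (x <= y)%R -> (y <= 4 * x)%R -> (phi y <= D * phi x)%R.
Proof.
move=> phi_adm; have [beta beta0 H] := admissible_growth phi_adm.
exists (expR (beta * 3)); first exact: expR_gt0.
move=> x y x1 xy yx; apply: le_trans (H _ _ x1 xy) _.
have x0 : (0 < x)%R by exact: lt_trans x1.
rewrite ler_wpM2r//.
  by case: phi_adm => /(_ x (ltW x1)) + _ _ _; apply: le_trans; exact: ler01.
by rewrite ler_expR ler_wpM2l ?(ltW beta0)// ler_pdivrMr//; lra.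
Qed.

End admissible_theory.

(** * Comparison of the sum over [k] with the logarithmic integral *)

Lemma integral_inv (R : realType) (a b : R) : (0 < a)%R -> (a < b)%R ->
  \int[lebesgue_measure]_(s in `]a, b[) (s^-1)%:E = (ln b - ln a)%:E.
Proof.
move=> a0 ab.
have minv (D : set R) : measurable D -> D `<=` `]0%R, +oo[ ->
    measurable_fun D (fun s : R => (s^-1)%:E).
  move=> mD D0; apply: measurable_funS D0 _; first exact: measurable_itv.
  apply/measurable_EFinP; apply: open_continuous_measurable_fun;
    [exact: interval_open|move=> s].
  rewrite inE/= in_itv/= andbT => s0; apply: inv_continuous.
  by rewrite gt_eqF.
rewrite integral_itv_bndo_bndc; last first.
  by apply: minv => //; apply: subset_itv; rewrite bnd_simp// ltW.
rewrite integral_itv_obnd_cbnd; last first.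
  by apply: minv => //; apply: subset_itv; rewrite bnd_simp// ltW.
rewrite (@continuous_FTC2 _ _ (@ln R))//.
- apply: continuous_in_subspaceT => x; rewrite inE/= in_itv/= => /andP[ax _].
  by apply: inv_continuous; rewrite gt_eqF// (lt_le_trans a0).
- split.
  + move=> x; rewrite in_itv/= => /andP[ax _].
    by have [] := is_derive1_ln (lt_trans a0 ax).
  + exact/cvg_at_right_filter/continuous_ln.
  + exact/cvg_at_left_filter/continuous_ln/(lt_trans a0).
- move=> x; rewrite in_itv/= => /andP[ax _].
  by rewrite derive1E; have [_ ->] := is_derive1_ln (lt_trans a0 ax).
Qed.

Section logarithmic_tail.
Context {R : realType}.
Local Notation leb := (@lebesgue_measure R).
Variables (phi : R -> R) (F : R -> \bar R) (t : R).
Hypotheses (phi_adm : admissible phi) (t0 : (0 < t)%R).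
Hypotheses (mF : measurable_fun setT F) (F0 : forall s, 0 <= F s).
Hypothesis F_nincr : {homo F : r s / (r <= s)%R >-> s <= r}.

Let w s := ((1 + ln (s / t))^-1 * phi (1 + ln (s / t)))%R.
Let W s := (w s)%:E * F s * (s^-1)%:E.

Let lnst_gt0 s : (t < s)%R -> (0 < ln (s / t))%R.
Proof. by move=> ts; rewrite ln_gt0// ltr_pdivlMr// mul1r. Qed.

Let measurable_W : measurable_fun (`]t, +oo[%classic : set R) W.
Proof.
apply: emeasurable_funM; last first.
  apply/measurable_EFinP; apply: open_continuous_measurable_fun;
    [exact: interval_open|move=> s].
  rewrite inE/= in_itv/= andbT => ts; apply: inv_continuous.
  by rewrite gt_eqF// (lt_trans t0).
apply: emeasurable_funM; last exact: measurable_funTS.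
apply/measurable_EFinP; apply: open_continuous_measurable_fun;
    [exact: interval_open|move=> s].
rewrite inE/= in_itv/= andbT => ts.
have st0 : (0 < s / t)%R by rewrite divr_gt0// (lt_trans t0).
have cl : {for s, continuous (fun s : R => 1 + ln (s / t))%R}.
  apply: cvgD; first exact: cvg_cst.
  apply: (@continuous_comp _ _ _ (fun s : R => s / t)%R); last exact: continuous_ln.
  by apply: cvgM; [exact: cvg_id|exact: cvg_cst].
have l1 : (1 < 1 + ln (s / t))%R by rewrite ltrDl lnst_gt0.
apply: cvgM; last first.
  apply: (@continuous_comp _ _ _ (fun s : R => 1 + ln (s / t))%R) => //.
  exact: admissible_continuous.
apply: (@continuous_comp _ _ _ (fun s : R => 1 + ln (s / t))%R) => //.
by apply: inv_continuous; rewrite gt_eqF// (lt_trans ltr01).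
Qed.

Let W_ge0 s : (t < s)%R -> 0 <= W s.
Proof.
move=> ts; rewrite /W !mule_ge0//; last first.
  by rewrite lee_fin invr_ge0 ltW// (lt_trans t0).
have l1 : (1 <= 1 + ln (s / t))%R by rewrite lerDl ltW// lnst_gt0.
rewrite lee_fin mulr_ge0 ?invr_ge0 ?(le_trans ler01)//.
by case: phi_adm => /(_ _ l1).
Qed.

Let outer k := (t * expR (2 ^+ k))%R.
(** Written [2 ^+ k / 2] because [2 ^+ k.-1] is 1 at [k = 0] and would make the first shell
    empty. *)
Let inner k := (t * expR (2 ^+ k / 2))%R.

Let inner_outer k : (t < inner k < outer k)%R.
Proof.
have k0 : (0 < 2 ^+ k :> R)%R by rewrite exprn_gt0.
rewrite /inner /outer ltr_pMr// ltr_pM2l// ltr_expR expR_gt1; apply/andP; split; lra.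
Qed.

Let shell k := `]inner k, outer k[%classic.

Let shell_sub k : shell k `<=` `]t, +oo[.
Proof.
by apply: subset_itv; rewrite bnd_simp//; have /andP[/ltW] := inner_outer k.
Qed.

(** On the shell the integrand dominates [c / s], with [c] constant: [F] is smallest at the outer
    end, and the weight varies by a bounded factor since [1 + ln (s / t)] is comparable to [K]. *)
Let shell_le (D : R) k : (0 < D)%R ->
  (forall x y, (1 < x)%R -> (x <= y)%R -> (y <= 4 * x)%R -> (phi y <= D * phi x)%R) ->
  (phi (2 ^+ k.+1))%:E * F (outer k) <= (4 * D)%:E * \int[leb]_(s in shell k) W s.
Proof.
move=> D0 phiD; have /andP[ti io] := inner_outer k.
have k0 : (0 < 2 ^+ k :> R)%R by rewrite exprn_gt0.
have k1 : (1 <= 2 ^+ k :> R)%R by rewrite exprn_ege1// ler1n.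
pose K : R := (2 ^+ k.+1)%R.
have K2 : K = (2 * 2 ^+ k)%R by rewrite /K exprS.
have phiK : (0 < phi K)%R.
  by case: phi_adm => /(_ K) + _ _ _;
    move=> /(_ _)/(lt_le_trans ltr01)-> //; rewrite K2; lra.
have i0 : (0 < inner k)%R by exact: lt_trans ti.
pose c : \bar R := (phi K / (D * K))%:E * F (outer k).
have c0 : 0 <= c.
  by rewrite mule_ge0// lee_fin divr_ge0 ?(ltW phiK)// mulr_ge0 ?(ltW D0)// K2; lra.
have cW s : shell k s -> c * (s^-1)%:E <= W s.
  rewrite /shell /= in_itv/= => /andP[si so].
  have s0 : (0 < s)%R by exact: lt_trans si.
  have st0 : (0 < s / t)%R by rewrite divr_gt0.
  have ui : (2 ^+ k / 2 < ln (s / t))%R.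
    by rewrite -ltr_expR lnK ?posrE// ltr_pdivlMr// mulrC.
  have uo : (ln (s / t) < 2 ^+ k)%R.
    by rewrite -ltr_expR lnK ?posrE// ltr_pdivrMr// mulrC.
  rewrite /W lee_wpmul2r ?lee_fin ?invr_ge0 ?(ltW s0)//.
  apply: lee_pmul => //.
  - by rewrite lee_fin divr_ge0 ?(ltW phiK)// mulr_ge0 ?(ltW D0)// K2; lra.
  - rewrite lee_fin /w; set u := ln (s / t) in ui uo *.
    (* From [2^k / 2 < u < 2^k] and [1 <= 2^k] follow [1 + u <= K <= 4 (1 + u)]. *)
    have phiu : (phi K <= D * phi (1 + u))%R by apply: phiD; rewrite ?K2; lra.
    have -> : (phi K / (D * K) = K^-1 * (phi K / D))%R by rewrite invfM mulrA mulrC.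
    apply: ler_pM.
    + by rewrite invr_ge0 K2; lra.
    + by rewrite divr_ge0 ?(ltW D0) ?(ltW phiK).
    + by rewrite lef_pV2 ?posrE ?K2; lra.
    + by rewrite ler_pdivrMr// mulrC.
  - exact/F_nincr/ltW.
have mshell : measurable (shell k) by exact: measurable_itv.
have minv : measurable_fun (shell k) (fun s : R => (s^-1)%:E).
  apply/measurable_EFinP; apply: open_continuous_measurable_fun;
    [exact: interval_open|move=> s].
  rewrite inE /shell/= in_itv/= => /andP[si _]; apply: inv_continuous.
  by rewrite gt_eqF// (lt_trans i0).
(* The shell has [ds/s]-mass [2^k - 2^k / 2 = K / 4], which against the [1 / (D K)] in [c] leaves
   [1 / (4 D)]. *)
have -> : (phi K)%:E * F (outer k) =
    (4 * D)%:E * \int[leb]_(s in shell k) (c * (s^-1)%:E).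
  rewrite ge0_integralZl//; last first.
    move=> s; rewrite /shell /= in_itv/= => /andP[si _].
    by rewrite lee_fin invr_ge0 ltW// (lt_trans i0).
  rewrite /shell integral_inv// /inner /outer !lnM ?posrE ?expR_gt0// !expRK.
  rewrite /c muleAC muleA -!EFinM; congr (_%:E * _).
  by rewrite K2; field; rewrite !gt_eqF.
rewrite lee_pmul2l ?lte_fin ?mulr_gt0//.
apply: ge0_le_integral => //.
- move=> s; rewrite /shell /= in_itv/= => /andP[si _].
  by rewrite mule_ge0// lee_fin invr_ge0 ltW// (lt_trans i0).
- by apply: emeasurable_funM => //; exact: measurable_cst.
- exact: measurable_funS (@shell_sub k) measurable_W.
Qed.

Let shell_sum_le :
  \sum_(0 <= k <oo) \int[leb]_(s in shell k) W s <= \int[leb]_(s in `]t, +oo[) W s.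
Proof.
have tshell : trivIset setT shell.
  apply: ltn_trivIset => // i j ij; apply/seteqP; split => // s [].
  rewrite /shell /= !in_itv/= => /andP[_ so] /andP[si _].
  have := lt_trans si so; apply/negP; rewrite -leNgt ler_pM2l// ler_expR.
  by rewrite ler_pdivlMr// -exprSr ler_eXn2l// ltr1n.
rewrite -ge0_integral_bigcup//.
- apply: ge0_subset_integral => //.
  + by apply: bigcupT_measurable => k; exact: measurable_itv.
  + by move=> s; rewrite /= in_itv/= andbT; exact: W_ge0.
  + by apply: bigcup_sub => k _; exact: shell_sub.
- by move=> k; exact: measurable_itv.
- apply: measurable_funS measurable_W => //.
  by apply: bigcup_sub => k _; exact: shell_sub.
- by move=> s [k _ /shell_sub]; rewrite /= in_itv/= andbT; exact: W_ge0.
Qed.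

Lemma log_tail_sum_le (D : R) : (0 < D)%R ->
  (forall x y, (1 < x)%R -> (x <= y)%R -> (y <= 4 * x)%R -> (phi y <= D * phi x)%R) ->
  \sum_(0 <= k <oo) (phi (2 ^+ k.+1))%:E * F (t * expR (2 ^+ k)) <=
  (4 * D)%:E * \int[leb]_(s in `]t, +oo[)
    (((1 + ln (s / t))^-1 * phi (1 + ln (s / t)))%:E * F s * (s^-1)%:E).
Proof.
move=> D0 phiD; have D4 : (0 <= 4 * D)%R by rewrite mulr_ge0// ltW.
apply: le_trans (lee_wpmul2l _ shell_sum_le); last by rewrite lee_fin.
rewrite -nneseriesZl; last first.
  move=> k _; apply: integral_ge0 => s /shell_sub.
  by rewrite /= in_itv/= andbT; exact: W_ge0.
apply: lee_nneseries => [k _ _|k _]; last exact: shell_le.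
rewrite mule_ge0// lee_fin (le_trans ler01)//.
by case: phi_adm => /(_ (2 ^+ k.+1)%R) + _ _ _; apply; rewrite exprn_ege1// ler1n.
Qed.

(** The head of the cut ends at [s_0 = t e], not at [t]. By monotonicity the excess is at most
    [t c F(t)], and [t F(t)] is at most the integral over []0, t[]. *)
Lemma integral_nincr_dilate (c : R) : (1 < c)%R ->
  \int[leb]_(s in `]0%R, (t * c)%R[) F s <= (1 + c)%:E * \int[leb]_(s in `]0%R, t[) F s.
Proof.
move=> c1; have c0 : (0 < c)%R by exact: lt_trans c1.
have ttc : (t < t * c)%R by rewrite ltr_pMr.
have mFT (D : set R) : measurable_fun D F by exact: measurable_funTS.
have tF : t%:E * F t <= \int[leb]_(s in `]0%R, t[) F s.
  rewrite muleC [t%:E](_ : _ = leb `]0%R, t[%classic); last first.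
    by rewrite lebesgue_measure_itv/= lte_fin t0 oppr0 adde0.
  rewrite -integral_cst//; apply: ge0_le_integral => //;
    [by move=> s _; exact: F0|exact: mFT|].
  by move=> s; rewrite /= in_itv/= => /andP[_ /ltW]; exact: F_nincr.
have -> : `]0%R, (t * c)%R[%classic = `]0%R, t[%classic `|` `[t, (t * c)%R[%classic.
  by rewrite -itv_bndbnd_setU// bnd_simp// ltW.
rewrite ge0_integral_setU; first last.
- rewrite disj_set2E; apply/eqP/seteqP; split => // s [].
  by rewrite /= !in_itv/= => /andP[_ st] /andP[ts _]; move: ts; rewrite leNgt st.
- by move=> s _; exact: F0.
- exact: mFT.
- exact: measurable_itv.
- exact: measurable_itv.
rewrite EFinD ge0_muleDl ?lee_fin ?(ltW c0)// mul1e leeD2l//.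
apply: (@le_trans _ _ ((t * c)%:E * F t)); last first.
  by rewrite mulrC EFinM -muleA lee_wpmul2l// lee_fin ltW.
rewrite muleC; apply: (@le_trans _ _ (F t * leb `[t, (t * c)%R[%classic)).
  rewrite -integral_cst//; apply: ge0_le_integral => //; first exact: mFT.
  by move=> s; rewrite /= in_itv/= => /andP[ts _]; exact: F_nincr.
rewrite lebesgue_measure_itv/= lte_fin ttc -EFinB lee_wpmul2l// lee_fin.
by rewrite lerBlDr lerDl ltW.
Qed.

End logarithmic_tail.

(** * The cut of [f] and the final estimate *)

Lemma nneseries_le_recl (R : realType) (a : (\bar R)^nat) : (forall k, 0 <= a k) ->
  \sum_(0 <= k <oo) a k <= a 0%N + \sum_(0 <= k <oo) a k.+1.
Proof.
move=> a0; apply: lime_le; first by apply: is_cvg_nneseries => *; exact: a0.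
near=> n; have n0 : (0 < n)%N by near: n; exact: nbhs_infty_gt.
rewrite -(prednK n0) big_nat_recl//= leeD2l//.
by apply: nneseries_lim_ge => *; exact: a0.
Unshelve. all: end_near. Qed.

Lemma powR_inv_le (R : realType) (x y c p : R) : (0 < p)%R ->
  (0 <= x)%R -> (0 <= y)%R -> (0 <= c)%R -> (x <= y * c `^ p)%R ->
  (x `^ p^-1 <= y `^ p^-1 * c)%R.
Proof.
move=> p0 x0 y0 c0 xy; have q0 : (0 <= p^-1)%R by rewrite invr_ge0 ltW.
rewrite -[X in (_ * X)%R]powRr1// -(mulfV (lt0r_neq0 p0)) powRrM -powRM ?powR_ge0//.
by apply: ge0_ler_powR => //; rewrite nnegrE ?mulr_ge0 ?powR_ge0.
Qed.

Section pointwise_bound.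
Context d (X : measurableType d) {R : realType}.
Variables (mu : {measure set X -> \bar R}) (T : (X -> R) -> X -> \bar R).
Variables (phi : R -> R) (C : R).
Hypotheses (T_sub : sublinear_operator mu T) (phi_adm : admissible phi).
Hypothesis C0 : (0 < C)%R.
Hypothesis T_weak : forall p f, (1 <= p)%R -> measurable_fun setT f ->
  lorentz_weak mu p (T f) <= (C * phi p)%:E * lorentz_strong mu p (EFin \o f).

Section fixed_function.
Variables (f : X -> R) (t : R).
Hypotheses (mf : measurable_fun setT f) (t0 : (0 < t)%R).

Local Notation r := (rearrangement mu (EFin \o f)).
Local Notation leb := (@lebesgue_measure R).
Let s k := (t * expR (2 ^+ k))%R.
(* The zero set of [f] is adjoined so that the pieces [E k] cover the space. *)
Let U k := [set x | r (s k) < `|(f x)%:E|] `|` [set x | f x = 0%R].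
Let E := seqD U.
Let head := \int[leb]_(u in `]0%R, s 0[) r u.
Let coef k := (phi (2 ^+ k.+1))%:E * r (s k).
(** Heights solving the weak-type bound for the allotted measures: for the top piece
    [(t / 4) (4 C / t) = C]; for the others [4 e] dominates [(s_(k+1) / tau_(k+1))^(1/p)]. *)
Let a k := if k is k'.+1 then (4 * expR 1 * C)%:E * coef k' else (4 * C / t)%:E * head.
(** The exponent [k + 2] makes the total [t / 2]. *)
Let tau k : \bar R := (t / (2 ^ (k + 2))%:R)%:E.

Let phi_gt0 p : (1 <= p)%R -> (0 < phi p)%R.
Proof. by move=> p1; case: phi_adm => /(_ p p1) + _ _ _; exact: lt_le_trans. Qed.

Let pow2_ge1 k : (1 <= 2 ^+ k :> R)%R.
Proof. by rewrite exprn_ege1// ler1n. Qed.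

Let s_gt0 k : (0 < s k)%R. Proof. by rewrite mulr_gt0 ?expR_gt0. Qed.

Let coef_ge0 k : 0 <= coef k.
Proof. by rewrite mule_ge0 ?rearrangement_ge0// lee_fin ltW// phi_gt0. Qed.

Let head_ge0 : 0 <= head.
Proof. by apply: integral_ge0 => u _; exact: rearrangement_ge0. Qed.

Let a_ge0 k : 0 <= a k.
Proof.
case: k => [|k] /=; rewrite mule_ge0 ?coef_ge0 ?head_ge0// lee_fin.
  by rewrite divr_ge0 ?mulr_ge0// ltW.
by rewrite !mulr_ge0 ?expR_ge0// ltW.
Qed.

Let mEf : measurable_fun setT (EFin \o f).
Proof. exact/measurable_EFinP. Qed.

Let mU k : measurable (U k).
Proof.
apply: measurableU; first exact: (measurable_superlevel _ mEf).
by rewrite -[X in measurable X]setTI; apply: (mf measurableT (measurable_set1 _)).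
Qed.

Let ndU : nondecreasing_seq U.
Proof.
move=> m n mn; apply/subsetPset => x [rx|]; [left|by right].
apply: le_lt_trans rx; apply: rearrangement_nincr.
by rewrite ler_pM2l// ler_expR ler_eXn2l// ltr1n.
Qed.

Let mE k : measurable (E k).
Proof. by case: k => [|k] /=; [exact: mU|exact: measurableD]. Qed.

Let piece k x := (f x * \1_(E k) x)%R.

Let mpiece k : measurable_fun setT (piece k).
Proof. by apply: measurable_funM => //; exact: measurable_indic. Qed.

(** The zero set adjoined to [U k] contributes nothing to the support, and [{|f| > f^*(s_k)}] has
    measure at most [s_k] by [superlevel_le]. *)
Let piece_support k : mu [set x | 0 < `|(EFin \o piece k) x|] <= (s k)%:E.
Proof.
apply: (@le_trans _ _ (mu [set x | r (s k) < `|(EFin \o f) x|])); last first.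
  by apply: superlevel_le => //; exact: ltW.
apply: le_measure; rewrite ?inE; [|exact: measurable_superlevel|].
  by apply: measurable_superlevel; exact/measurable_EFinP.
move=> x; rewrite /= /piece lte_fin normr_gt0 mulf_eq0 negb_or => /andP[/eqP fx0].
rewrite indicE; have [xE _|//] := boolP (x \in E k); last by rewrite eqxx.
have : U k x by move/set_mem : xE; case: (k) => [|j] //= [].
by case.
Qed.

Let piece_le k x : `|(EFin \o piece k) x| <= `|(EFin \o f) x|.
Proof.
rewrite /= lee_fin normrM indicE; case: (_ \in _); rewrite ?normr1 ?mulr1//.
by rewrite normr0 mulr0.
Qed.

Let piece_bounded k x : `|(EFin \o piece k.+1) x| <= r (s k).
Proof.
rewrite /= /piece indicE; have [/set_mem[_ nU]|_] := boolP (x \in E k.+1).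
  by rewrite mulr1 leNgt; apply/negP => rf; apply: nU; left.
by rewrite mulr0 normr0 rearrangement_ge0.
Qed.

(** The top piece has no height bound. At [p = 1] the weight [s^(1/p - 1)] is 1, so its norm is at
    most [head], and [phi 1 = 1]. *)
Let piece0_weak : mu [set x | a 0 < `|T (piece 0) x|] <= tau 0.
Proof.
have tau0 : (0 < t / (2 ^ (0 + 2))%:R)%R by rewrite divr_gt0// ltr0n expn_gt0.
have M_gt0 p : (1 <= p)%R -> (0 < C * phi p)%R by move=> ?; rewrite mulr_gt0// phi_gt0.
apply: (weak_type_superlevel T_sub T_weak (lexx _) (mpiece 0) tau0 (a_ge0 0)).
rewrite (@lorentz_strong_support _ _ _ _ 1%R _ (s 0))//; last 2 first.
  exact/measurable_EFinP.
  exact: ltW.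
case: phi_adm => _ -> _ _; rewrite mulr1 invr1 mul1e subrr powRr1 ?(ltW tau0)//.
rewrite muleA -EFinM (_ : (t / _ * _)%R = C); last first.
  by rewrite (_ : (2 ^ (0 + 2))%N = 4%N)//; field; rewrite gt_eqF.
apply: lee_wpmul2l; first by rewrite lee_fin ltW.
apply: ge0_le_integral => //.
- by move=> u _; rewrite mule_ge0 ?rearrangement_ge0// lee_fin powR_ge0.
- apply: emeasurable_funM; first exact: measurable_rearrangement.
  exact: measurable_EFin_powR.
- exact: measurable_rearrangement.
- move=> u _; rewrite powRr0 mule1; apply: le_rearrangement => //.
  exact/measurable_EFinP.
Qed.

Let piece_weak k : mu [set x | a k.+1 < `|T (piece k.+1) x|] <= tau k.+1.
Proof.
set p : R := (2 ^+ k.+1)%R.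
have p1 : (1 <= p)%R by exact: pow2_ge1.
have p0 : (0 < p)%R by exact: lt_le_trans p1.
have tau0 : (0 < t / (2 ^ (k.+1 + 2))%:R)%R by rewrite divr_gt0// ltr0n expn_gt0.
apply: (weak_type_superlevel T_sub T_weak p1 (mpiece _) tau0 (a_ge0 _)).
have Cphi : (0 < C * phi p)%R by rewrite mulr_gt0// phi_gt0.
apply: le_trans (lee_wpmul2l _ (lorentz_strong_bounded p0 _ (s_gt0 k.+1)
  (piece_support _) (rearrangement_ge0 _ _ _) (piece_bounded k))) _.
- by rewrite lee_fin ltW.
- exact/measurable_EFinP.
rewrite /a /coef -/p [r _ * _]muleC !muleA -!EFinM.
apply: lee_wpmul2r; first exact: rearrangement_ge0.
rewrite lee_fin.
(* [p] = ln (s k.+1 / t), so that (s k.+1 / tau k.+1) ^ (1 / p) is bounded in [k]. *)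
have sk : (s k.+1 <= t / (2 ^ (k.+1 + 2))%:R * (4 * expR 1) `^ p)%R.
  rewrite powRM ?expR_ge0// -expRM mul1r /s -/p -mulrA ler_wpM2l ?(ltW t0)//.
  rewrite mulrA ler_peMl ?expR_ge0// mulrC ler_pdivlMr ?ltr0n ?expn_gt0// mul1r.
  (* What remains is [2^(k+3) <= 4^p = 2^(2^(k+2))], that is [k + 2 < 2^(k+2)]. *)
  rewrite /p -natrX powR_mulrn// -natrX ler_nat -[4%N]/(2 ^ 2)%N -expnM leq_exp2l//.
  by rewrite -expnS addn2; exact: ltn_expl.
have := powR_inv_le p0 (ltW (s_gt0 _)) (ltW tau0) (mulr_ge0 (ler0n _ 4) (expR_ge0 1)) sk.
move=> /(ler_wpM2l (ltW Cphi))/le_trans; apply.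
by rewrite le_eqVlt; apply/orP; left; apply/eqP; ring.
Qed.

Let tau_sum : \sum_(0 <= k <oo) tau k <= (t / 2)%:E.
Proof.
have := @cvg_geometric_eseries_half R t 1; rewrite expr1 => /cvg_lim <- //.
Qed.

(** A point [x] missed by all [U k] has [f x] nonzero and [|f x| <= f^*(s_k)] for every [k]. As
    [phi >= 1], every [a k.+1] is then at least the positive constant [4 e C |f x|], and the series
    diverges. *)
Let cover : \sum_(0 <= k <oo) a k < +oo -> \bigcup_k E k = setT.
Proof.
move=> aoo; rewrite eq_bigcup_seqD; apply/seteqP; split => // x _.
apply: contrapT => nUx.
have fx k : ((`|f x|)%:E <= r (s k)) /\ f x <> 0%R.
  split=> [|fx0]; last by apply: nUx; exists 0%N => //; right.
  by rewrite leNgt; apply/negP => rf; apply: nUx; exists k => //; left.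
have fx0 : (0 < `|f x|)%R by rewrite normr_gt0; apply/eqP; have [] := fx 0%N.
pose c : R := (4 * expR 1 * C * `|f x|)%R.
have c0 : (0 < c)%R by rewrite /c !mulr_gt0// expR_gt0.
have ac k : c%:E <= a k.+1.
  rewrite /= /c EFinM; apply: lee_wpmul2l.
    by rewrite lee_fin !mulr_ge0 ?expR_ge0// ltW.
  have [fxr _] := fx k; apply: le_trans fxr _.
  rewrite /coef lee_pemull ?rearrangement_ge0//.
  by rewrite lee_fin; case: phi_adm => /(_ (2 ^+ k.+1)%R (pow2_ge1 _)).
have sumc N : (N%:R * c)%:E <= \sum_(0 <= k < N.+1) a k.
  elim: N => [|N IH]; first by rewrite mul0r; apply: sume_ge0.
  rewrite big_nat_recr//= -natr1 mulrDl mul1r EFinD; apply: leeD => //.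
  exact: ac.
move: aoo; rewrite ltNge => /negP; apply; rewrite leye_eq; apply/eqP/eqyP => A A0.
apply: (@le_trans _ _ ((Num.truncn (A / c)).+1%:R * c)%:E).
  by rewrite lee_fin -ler_pdivrMr// ltW// truncnS_gt.
by apply: le_trans (sumc _) _; apply: nneseries_lim_ge.
Qed.

Lemma rearrangement_le_shells :
  in_lorentz_sum mu f \/ countably_sublinear_at mu T f ->
  rearrangement mu (T f) t <=
    (4 * C / t)%:E * \int[leb]_(u in `]0%R, (t * expR 1)%R[) r u +
    (4 * expR 1 * C)%:E *
      \sum_(0 <= k <oo) (phi (2 ^+ k.+1))%:E * r (t * expR (2 ^+ k)).
Proof.
move=> hyp; apply: (@le_trans _ _ (\sum_(0 <= k <oo) a k)); last first.
  apply: le_trans (nneseries_le_recl a_ge0) _.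
  rewrite /= nneseriesZl; last by move=> k _; exact: coef_ge0.
  by rewrite /head /s expr0.
have [aoo|] := ltP (\sum_(0 <= k <oo) a k) +oo; last first.
  by rewrite leye_eq => /eqP ->; rewrite leey.
apply: (rearrangement_le_sum T_sub _ T_weak mf mE (trivIset_seqD ndU) (cover aoo)
  t0 a_ge0 _ tau_sum hyp).
- by move=> p p1; rewrite mulr_gt0// phi_gt0.
- by case=> [|k]; [exact: piece0_weak|exact: piece_weak].
Qed.

End fixed_function.

(** Holds for an arbitrary measure; [C'] is built from [C] and the doubling constant of [phi]
    alone. *)
Lemma rearrangement_sublinear_bound : exists C' : R, (0 < C')%R /\
  forall (t : R) (f : X -> R), (0 < t)%R -> measurable_fun setT f ->
    in_lorentz_sum mu f \/ countably_sublinear_at mu T f ->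
    rearrangement mu (T f) t <=
    C'%:E *
      ((t^-1)%:E * \int[lebesgue_measure]_(s in `]0%R, t[)
         rearrangement mu (EFin \o f) s +
       \int[lebesgue_measure]_(s in `]t, +oo[)
         (((1 + ln (s / t))^-1 * phi (1 + ln (s / t)))%:E *
          rearrangement mu (EFin \o f) s * (s^-1)%:E)).
Proof.
have [D D0 phiD] := admissible_doubling phi_adm.
have e0 : (0 < expR 1 :> R)%R by exact: expR_gt0.
(* [C1] is the head constant [4 C] times the cost [1 + e] of dilating by [e]; [C2] is the height
   constant [4 e C] times the [4 D] of [log_tail_sum_le]. *)
pose C1 : R := (4 * C * (1 + expR 1))%R.
pose C2 : R := (4 * expR 1 * C * (4 * D))%R.
have C10 : (0 < C1)%R by rewrite !mulr_gt0// addr_gt0.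
have C20 : (0 < C2)%R by rewrite !mulr_gt0.
exists (C1 + C2)%R; split; first exact: addr_gt0.
move=> t f t0 mf hyp; apply: le_trans (rearrangement_le_shells mf t0 hyp) _.
set r := rearrangement mu (EFin \o f).
have mr : measurable_fun setT r by exact: measurable_rearrangement.
have r0 s : 0 <= r s by exact: rearrangement_ge0.
have r_nincr : {homo r : s s' / (s <= s')%R >-> s' <= s}.
  by move=> ? ?; exact: rearrangement_nincr.
set H := (X in (t^-1)%:E * X).
set W := (X in _ * (_ * H + X)).
have H0 : 0 <= (t^-1)%:E * H.
  by rewrite mule_ge0 ?integral_ge0// lee_fin invr_ge0 ltW.
have W0 : 0 <= W.
  apply: integral_ge0 => s; rewrite /= in_itv/= andbT => ts.
  have s0 : (0 < s)%R by exact: lt_trans ts.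
  have l0 : (0 <= ln (s / t))%R by rewrite ln_ge0// ler_pdivlMr// mul1r ltW.
  rewrite !mule_ge0// lee_fin ?invr_ge0 ?(ltW s0)// mulr_ge0 ?invr_ge0 ?addr_ge0//.
  have l1 : (1 <= 1 + ln (s / t))%R by rewrite lerDl.
  by case: phi_adm => /(_ _ l1) + _ _ _; apply: le_trans.
have head_le :
    (4 * C / t)%:E * \int[lebesgue_measure]_(u in `]0%R, (t * expR 1)%R[) r u <=
    (C1 + C2)%:E * ((t^-1)%:E * H).
  apply: (@le_trans _ _ (C1%:E * ((t^-1)%:E * H))); last first.
    by apply: lee_wpmul2r => //; rewrite lee_fin lerDl ltW.
  have e1 : (1 < expR 1 :> R)%R by rewrite expR_gt1.
  apply: le_trans (lee_wpmul2l _ (integral_nincr_dilate t0 mr r0 r_nincr e1)) _.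
    by rewrite lee_fin divr_ge0 ?mulr_ge0// ltW.
  rewrite !muleA -!EFinM; apply: lee_wpmul2r; first exact: integral_ge0.
  by rewrite lee_fin /C1 le_eqVlt; apply/orP; left; apply/eqP; ring.
have tail_le : (4 * expR 1 * C)%:E *
    \sum_(0 <= k <oo) (phi (2 ^+ k.+1))%:E * r (t * expR (2 ^+ k))%R <=
    (C1 + C2)%:E * W.
  apply: (@le_trans _ _ (C2%:E * W)); last first.
    by apply: lee_wpmul2r => //; rewrite lee_fin lerDr ltW.
  rewrite /C2 [in leRHS]EFinM -muleA; apply: lee_wpmul2l; last exact: log_tail_sum_le.
  by rewrite lee_fin !mulr_ge0// ltW.
rewrite [leRHS](ge0_muleDr _ H0 W0); exact: leeD head_le tail_le.
Qed.

End pointwise_bound.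

Theorem corollary1p7 (R : realType) (n : nat) (n_gt0 : (0 < n)%N)
    (T : (n.-tuple R -> R) -> n.-tuple R -> \bar R)
    (phi : R -> R) (C : R) :
  sublinear_operator (lebesgue_tuple n) T ->
  admissible phi ->
  (0 < C)%R ->
  (forall (p : R) (f : n.-tuple R -> R), (1 <= p)%R -> measurable_fun setT f ->
    lorentz_weak (lebesgue_tuple n) p (T f) <=
    (C * phi p)%:E * lorentz_strong (lebesgue_tuple n) p (EFin \o f)) ->
  exists C' : R, (0 < C')%R /\
    forall (t : R) (f : n.-tuple R -> R), (0 < t)%R -> measurable_fun setT f ->
      in_lorentz_sum (lebesgue_tuple n) f \/
        countably_sublinear_at (lebesgue_tuple n) T f ->
      rearrangement (lebesgue_tuple n) (T f) t <=
      C'%:E *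
        ((t^-1)%:E * \int[lebesgue_measure]_(s in `]0%R, t[)
           rearrangement (lebesgue_tuple n) (EFin \o f) s +
         \int[lebesgue_measure]_(s in `]t, +oo[)
           (((1 + ln (s / t))^-1 * phi (1 + ln (s / t)))%:E *
            rearrangement (lebesgue_tuple n) (EFin \o f) s * (s^-1)%:E)).
Proof.
by move=> T_sub phi_adm C0 T_weak; exact: rearrangement_sublinear_bound T_weak.
Qed.
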